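(* Let $\Gamma^{\overline k}=\{T\in\mathrm{C}^\times: T\,\mathrm{C}^{\overline k}\,T^{-1}\subseteq\mathrm{C}^{\overline k}\}$ for $k=0,1,2,3$. <ul> <li>If $n\ge4$ and $n\equiv0\pmod 4$: $\mathrm{Q}=\Gamma^{\overline1}=\Gamma^{\overline3}$ and $\mathrm{Q}'=\Gamma^{\overline0}=\Gamma^{\overline2}$, and $\mathrm{Q}\neq\mathrm{Q}'$.</li> <li>If $n\ge4$ and $n\equiv1,2,3\pmod4$: $\mathrm{Q}=\Gamma^{\overline0}=\Gamma^{\overline1}=\Gamma^{\overline2}=\Gamma^{\overline3}$.</li> <li>If $n=2$: $\Gamma^{\overline0}=\mathrm{C}^\times$, and $\Gamma^{\overline1}=\Gamma^{\overline2}=\mathrm{Q}=\mathrm{P}=\mathrm{C}^{\times(0)}\cup\mathrm{C}^{\times(1)}$, and this group is different from $\mathrm{C}^\times$.</li> <li>If $n=3$: $\Gamma^{\overline0}=\Gamma^{\overline3}=\mathrm{C}^\times$, and $\Gamma^{\overline1}=\Gamma^{\overline2}=\mathrm{Q}=\mathrm{P}=\mathrm{Z}^\times\mathrm{C}^{\times(0)}$, and this group is different from $\mathrm{C}^\times$.</li> </ul> Consequently, for all $n\ge2$, $\Gamma^{\overline1}\subseteq\Gamma^{\overline k}$ for $k=0,1,2,3$, and $$\Gamma^{\overline1}=\mathrm{Q}=\{T\in\mathrm{C}^\times:\ T\,\mathrm{C}^{\overline k}\,T^{-1}\subseteq\mathrm{C}^{\overline k}\ \text{for}\ k=0,1,2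,3\}.$$
   Context: Let $\mathrm{C}$ be either the real Clifford algebra $C\ell_{p,q}$ with $p+q=n$, or the complex Clifford algebra $C\ell(\mathbb{C}^n)$, with $n\ge 2$. It has identity $e$ and generators $e_1,\dots,e_n$ satisfying $e_ae_b+e_be_a=2\eta_{ab}e$. In the real case $\eta=\mathrm{diag}(1,\dots,1,-1,\dots,-1)$ with $p$ entries $+1$ and $q$ entries $-1$. In the complex case $\eta=I_n$. $\mathrm{C}^k$ is the grade-$k$ subspace, spanned by the products $e_{a_1}\cdots e_{a_k}$ with $a_1<\dots<a_k$. For $m=0,1,2,3$ let $\mathrm{C}^{\overline m}=\bigoplus_{k\equiv m\pmod4}\mathrm{C}^k$. The even subspace is $\mathrm{C}^{(0)}=\bigoplus_{k\text{ even}}\mathrm{C}^k$ and the odd subspace is $\mathrm{C}^{(1)}=\bigoplus_{k\text{ odd}}\mathrm{C}^k$. The reversion $U\mapsto\tilde U$ is the linear anti-automorphism acting on $\mathrm{C}^k$ as $(-1)^{k(k-1)/2}$. For $S\subseteq\mathrm{C}$, $S^\times$ is the set of elements of $S$ invertible in $\mathrm{C}$, and $\mathrm{C}^{\times(j)}:=(\mathrm{C}^{(j)})^\times$. $\mathrm{Z}$ is the center: $\mathrm{Z}=\mathrm{C}^0$ for $n$ even and $\mathrm{Z}=\mathrm{C}^0\oplus\mathrm{C}^n$ for $n$ odd. Define: <ul> <li>$\mathrm{P}:=\mathrm{Z}^\times(\mathrm{C}^{\times(0)}\cup\mathrm{C}^{\times(1)})=\{WT: W\in\mathrm{Z}^\times,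 T\in\mathrm{C}^{\times(0)}\cup\mathrm{C}^{\times(1)}\}$;</li> <li>$\mathrm{Q}:=\{T\in\mathrm{P}:\tilde TT\in\mathrm{Z}^\times\}$;</li> <li>$\mathrm{Q}':=\{T\in\mathrm{P}:\tilde TT\in(\mathrm{C}^0\oplus\mathrm{C}^n)^\times\}$.</li> </ul> *)

(* Defs.v *)
(* Clifford algebras with a diagonal metric, built on the
   standard basis { e_A : A subset of {0..n-1} } (e_A = e_{a1}...e_{ak},
   a1 < ... < ak, e_set0 = identity e). *)
From HB Require Import structures.
From mathcomp Require Import all_boot all_order all_algebra.
From mathcomp Require Import complex reals.
Set Implicit Arguments. Unset Strict Implicit. Unset Printing Implicit Defensive.
Import Order.TTheory GRing.Theory Num.Theory.
Local Open Scope ring_scope.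

Section Clifford.
Variables (K : fieldType) (n : nat) (eta : 'I_n -> K).
(* eta i = eta_{ii}; the metric is diagonal: e_i e_j + e_j e_i = 2 eta_{ij} e *)

(* Elements of the Clifford algebra: coordinate functions on the basis blades. *)
Definition clif := {ffun {set 'I_n} -> K}.

Definition symdiff (A B : {set 'I_n}) := (A :\: B) :|: (B :\: A).

(* sign arising from reordering e_A e_B : (-1)^#{(a,b) : a in A, b in B, a > b} *)
Definition csign (A B : {set 'I_n}) : K :=
  (-1) ^+ #|[set ab : 'I_n * 'I_n |
             [&& ab.1 \in A, ab.2 \in B & (nat_of_ord ab.2 < nat_of_ord ab.1)%N]]|.

(* e_A e_B = csign A B * (prod_{i in A cap B} eta_i) e_{A symdiff B} *)
Definition cmul (U V : clif) : clif :=
  [ffun C => \sum_(A : {set 'I_n}) \sum_(B : {set 'I_n} | symdiff A B == C)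
                U A * V B * csign A B * \prod_(i in A :&: B) eta i].

Definition cone : clif := [ffun A => if A == set0 then 1 else 0].

Definition cunit (U : clif) : Prop :=
  exists V, cmul U V = cone /\ cmul V U = cone.

(* reversion: acts on C^k by (-1)^(k(k-1)/2) = (-1)^'C(k,2) *)
Definition crev (U : clif) : clif := [ffun A : {set 'I_n} => (-1) ^+ 'C(#|A|, 2) * U A].

Definition grade_mod4 (m : nat) (U : clif) : Prop :=
  forall A : {set 'I_n}, (#|A| %% 4 != m)%N -> U A = 0.
Definition even_part (U : clif) : Prop :=
  forall A : {set 'I_n}, odd #|A| -> U A = 0.
Definition odd_part (U : clif) : Prop :=
  forall A : {set 'I_n}, ~~ odd #|A| -> U A = 0.
Definition grade0n (U : clif) : Prop :=
  forall A : {set 'I_n}, A != set0 -> A != [set: 'I_n] -> U A = 0.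
(* the center Z: C^0 for n even, C^0 (+) C^n for n odd *)
Definition center (U : clif) : Prop :=
  forall A : {set 'I_n}, A != set0 -> (~~ odd n \/ A != [set: 'I_n]) -> U A = 0.

Definition units_in (S : clif -> Prop) (U : clif) : Prop := S U /\ cunit U.

Definition Pgrp (U : clif) : Prop :=
  exists W T, units_in center W /\
    (units_in even_part T \/ units_in odd_part T) /\ U = cmul W T.
Definition Qgrp (T : clif) : Prop :=
  Pgrp T /\ units_in center (cmul (crev T) T).
Definition Q'grp (T : clif) : Prop :=
  Pgrp T /\ units_in grade0n (cmul (crev T) T).

(* T C^{overline k} T^{-1} subseteq C^{overline k} (T^{-1} being any two-sided
   inverse of T; it is unique) *)
Definition preserves (k : nat) (T : clif) : Prop :=
  forall Ti, cmul T Ti = cone -> cmul Ti T = cone ->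
  forall U, grade_mod4 k U -> grade_mod4 k (cmul (cmul T U) Ti).

Definition Gamma (k : nat) (T : clif) : Prop := cunit T /\ preserves k T.

Definition evenodd_units (T : clif) : Prop :=
  units_in even_part T \/ units_in odd_part T.
Definition Zeven_units (U : clif) : Prop :=
  exists W T, units_in center W /\ units_in even_part T /\ U = cmul W T.

End Clifford.

Definition seteq {T : Type} (S1 S2 : T -> Prop) : Prop := forall x, S1 x <-> S2 x.
Definition subset {T : Type} (S1 S2 : T -> Prop) : Prop := forall x, S1 x -> S2 x.

Definition Theorem11_for (K : fieldType) (n : nat) (eta : 'I_n -> K) : Prop :=
  let G := Gamma eta in
  let Q := Qgrp eta in
  let Q' := Q'grp eta in
  let P := Pgrp eta in
  let Cx := cunit eta in
  [/\ ((4 <= n)%N -> (n %% 4)%N = 0%N ->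
        [/\ seteq Q (G 1%N), seteq Q (G 3%N), seteq Q' (G 0%N), seteq Q' (G 2%N)
          & ~ seteq Q Q']),
      ((4 <= n)%N -> (n %% 4)%N <> 0%N ->
        [/\ seteq Q (G 0%N), seteq Q (G 1%N), seteq Q (G 2%N) & seteq Q (G 3%N)]),
      (n = 2%N ->
        [/\ seteq (G 0%N) Cx,
            [/\ seteq (G 1%N) (evenodd_units eta), seteq (G 2%N) (evenodd_units eta),
                 seteq Q (evenodd_units eta) & seteq P (evenodd_units eta)]
          & ~ seteq (evenodd_units eta) Cx]),
      (n = 3%N ->
        [/\ seteq (G 0%N) Cx, seteq (G 3%N) Cx,
            [/\ seteq (G 1%N) (Zeven_units eta), seteq (G 2%N) (Zeven_units eta),
                seteq Q (Zeven_units eta) & seteq P (Zeven_units eta)]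
          & ~ seteq (Zeven_units eta) Cx]) &
      ((2 <= n)%N ->
        [/\ forall k, (k < 4)%N -> subset (G 1%N) (G k),
            seteq (G 1%N) Q
          & seteq Q (fun T => cunit eta T /\ forall k, (k < 4)%N -> preserves eta k T)])].

Definition eta_pq (R : realType) (p q : nat) : 'I_(p + q) -> R :=
  fun i => if (nat_of_ord i < p)%N then 1 else -1.
Definition eta_C (R : realType) (n : nat) : 'I_n -> R[i] := fun _ => 1.

(* Main.v *)
(* Reversion and the grade involution [ginv] are commuting involutions whose
   joint eigenspaces are the four subspaces C^{overline k}. Hence, for a unit T,
   conjugation by T preserves C^{overline k} if and only if both
   [reversion T * T] and [T^-1 * ginv T] centralize C^{overline k}. Since
   distinct blades commute or anticommute, this centralizer is spanned by
   blades: apart from small n it is Z for odd k and C^0 + C^n for even k.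

   If n is even and T^-1 ginv(T) lies in C^0 + C^n, then T is even or odd. If n
   is odd and T^-1 ginv(T) lies in Z, it is, up to sign, a quotient ginv(W) / W
   with W in Z (Hilbert 90), so that T / W is even or odd. In both cases T lies
   in P, and what remains of the condition is the one on [reversion T * T]
   defining Q or Q'. *)
From HB Require Import structures.
Require Import Defs.
From mathcomp Require Import all_boot all_order all_algebra.
From mathcomp Require Import complex reals zify.
Set Implicit Arguments. Unset Strict Implicit. Unset Printing Implicit Defensive.
Import Order.TTheory GRing.Theory Num.Theory.
Local Open Scope ring_scope.

(** * Subsets as an elementary abelian 2-group under symmetric difference *)

Section SymmetricDifference.
Variable n : nat.
Implicit Types A B C : {set 'I_n}.

Lemma in_symdiff A B i : (i \in symdiff A B) = (i \in A) (+) (i \in B).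
Proof. by rewrite !inE; case: (i \in A); case: (i \in B). Qed.

Lemma symdiffC A B : symdiff A B = symdiff B A.
Proof. by apply/setP => i; rewrite !in_symdiff addbC. Qed.

Lemma symdiffA A B C : symdiff A (symdiff B C) = symdiff (symdiff A B) C.
Proof. by apply/setP => i; rewrite !in_symdiff addbA. Qed.

Lemma symdiffKl A : involutive (symdiff A).
Proof. by move=> B; apply/setP => i; rewrite !in_symdiff addKb. Qed.

Lemma symdiffs0 A : symdiff A set0 = A.
Proof. by apply/setP => i; rewrite in_symdiff inE addbF. Qed.

Lemma symdiff0s A : symdiff set0 A = A.
Proof. by rewrite symdiffC symdiffs0. Qed.

Lemma symdiffv A : symdiff A A = set0.
Proof. by apply/setP => i; rewrite in_symdiff inE addbb. Qed.

Lemma symdiff_eq A B C : (symdiff A B == C) = (B == symdiff A C).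
Proof. by rewrite -(inv_eq (symdiffKl A)). Qed.

Lemma card_symdiff A B : #|symdiff A B| = (#|A :\: B| + #|B :\: A|)%N.
Proof.
rewrite /symdiff cardsU; have -> : (A :\: B) :&: (B :\: A) = set0.
  by apply/setP => i; rewrite !inE; case: (i \in A); case: (i \in B).
by rewrite cards0 subn0.
Qed.

Lemma odd_card_symdiff A B : odd #|symdiff A B| = odd #|A| (+) odd #|B|.
Proof.
rewrite card_symdiff -(cardsID B A) -(cardsID A B) (setIC B A) !oddD.
by do 3!case: (odd _).
Qed.

End SymmetricDifference.

(** * Structure constants of the blade basis and the ring axioms *)

Section StructureConstants.
Variables (K : fieldType) (n : nat) (eta : 'I_n -> K).
Implicit Types A B C : {set 'I_n}.

Lemma sign_card (T : finType) (P : pred T) :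
  (-1) ^+ #|[set x | P x]| = \prod_x (if P x then -1 else 1) :> K.
Proof. by rewrite -big_mkcond /= prodr_const cardsE. Qed.

Lemma csign_prod A B : csign K A B =
  \prod_(ab : 'I_n * 'I_n)
    (if [&& ab.1 \in A, ab.2 \in B & (ab.2 < ab.1)%N] then -1 else 1).
Proof. exact: sign_card. Qed.

(** The number of inversions is additive modulo 2 in the indicator function of each argument, and
    [symdiff] adds indicator functions modulo 2. *)
Lemma csign_symdiffl A B C :
  csign K (symdiff A B) C = csign K A C * csign K B C.
Proof.
rewrite !csign_prod -big_split; apply: eq_bigr => -[i j] _ /=.
rewrite in_symdiff; case: (i \in A); case: (i \in B); case: (j \in C);
  by case: (_ < _)%N; rewrite /= ?mulrNN ?mulr1 ?mul1r.
Qed.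

Lemma csign_symdiffr A B C :
  csign K A (symdiff B C) = csign K A B * csign K A C.
Proof.
rewrite !csign_prod -big_split; apply: eq_bigr => -[i j] _ /=.
rewrite in_symdiff; case: (i \in A); case: (j \in B); case: (j \in C);
  by case: (_ < _)%N; rewrite /= ?mulrNN ?mulr1 ?mul1r.
Qed.

(** The parity of c in e_A e_B = (-1)^c e_B e_A: of the [#|A| * #|B|] pairs of generators, all
    anticommute except the [#|A :&: B|] coincident ones. *)
Definition comm_sign A B : bool := odd (#|A| * #|B| + #|A :&: B|).

(** A pair with distinct entries is an inversion in exactly one of the two orders, a diagonal pair
    in neither. So the product of the two signs counts the off-diagonal pairs of A x B. *)
Lemma csignC A B : csign K A B = (-1) ^+ comm_sign A B * csign K B A.
Proof.
have csign2 : csign K B A * csign K B A = 1.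
  by rewrite /csign -exprD addnn -mul2n exprM sqrrN expr1n expr1n.
suff -> : (-1) ^+ comm_sign A B = csign K A B * csign K B A.
  by rewrite -mulrA csign2 mulr1.
rewrite signr_odd exprD -cardsX !csign_prod.
rewrite [X in _ = _ * X](reindex_inj (h := fun ab => (ab.2, ab.1))) /=; last first.
  by move=> [? ?] [? ?] [-> ->].
have -> : #|A :&: B| = #|[set ab in setX A B | ab.1 == ab.2]|.
  rewrite -(card_imset (f := fun i : 'I_n => (i, i))); last by move=> ? ? [].
  apply: eq_card => -[i j]; rewrite !inE /=; apply/imsetP/andP.
    by move=> [k]; rewrite inE => /andP[kA kB] [-> ->]; rewrite kA kB.
  by move=> [/andP[iA jB] /eqP ij]; exists i; rewrite ?inE ?iA ij // -ij.
have -> : #|setX A B| = #|[set ab : 'I_n * 'I_n | (ab.1 \in A) && (ab.2 \in B)]|.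
  by apply: eq_card => -[i j]; rewrite !inE.
have -> : #|[set ab in setX A B | ab.1 == ab.2]| =
   #|[set ab : 'I_n * 'I_n| [&& ab.1 \in A, ab.2 \in B & ab.1 == ab.2]]|.
  by apply: eq_card => -[i j]; rewrite !inE /= andbA.
rewrite !sign_card -!big_split; apply: eq_bigr => -[i j] _ /=.
rewrite -val_eqE /=.
case: (i \in A); case: (j \in B) => //=; rewrite ?mulr1 //.
by case: ltngtP; rewrite /= ?mulrNN ?mulr1 ?mul1r.
Qed.

Definition blade_coef A B : K := csign K A B * \prod_(i in A :&: B) eta i.

(** This is associativity on blades. The signs agree by bimultiplicativity; for the metric, an index
    contributes one factor to each side exactly when it lies in at least two of the three sets. *)
Lemma blade_coef_cocycle A B C :
  blade_coef A B * blade_coef (symdiff A B) C =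
  blade_coef A (symdiff B C) * blade_coef B C.
Proof.
have eta_cocycle : (\prod_(i in A :&: B) eta i) *
    (\prod_(i in symdiff A B :&: C) eta i) =
    (\prod_(i in A :&: symdiff B C) eta i) * (\prod_(i in B :&: C) eta i).
  rewrite !(big_mkcond (fun i => i \in _)) -!big_split; apply: eq_bigr => i _.
  rewrite !in_setI !in_symdiff.
  by do 3!case: (i \in _); rewrite /= ?mulr1 ?mul1r.
rewrite /blade_coef csign_symdiffl csign_symdiffr.
rewrite mulrACA eta_cocycle [RHS]mulrACA; congr (_ * _).
by rewrite !mulrA.
Qed.

Lemma blade_coefC A B :
  blade_coef A B = (-1) ^+ comm_sign A B * blade_coef B A.
Proof. by rewrite /blade_coef csignC -mulrA setIC. Qed.

Lemma blade_coef0s A : blade_coef set0 A = 1.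
Proof.
rewrite /blade_coef set0I big_set0 mulr1 csign_prod big1 // => -[i j] _ /=.
by rewrite inE.
Qed.

Lemma blade_coefs0 A : blade_coef A set0 = 1.
Proof.
by rewrite blade_coefC blade_coef0s /comm_sign cards0 muln0 setI0 cards0 mulr1.
Qed.

(** For given [A] and [C] a unique [B] satisfies [symdiff A B = C], so the product is a convolution
    twisted by [blade_coef]. *)
Lemma cmulE (U V : clif K n) C : cmul eta U V C =
  \sum_A U A * V (symdiff A C) * blade_coef A (symdiff A C).
Proof.
rewrite ffunE; apply: eq_bigr => A _.
rewrite (big_pred1 (symdiff A C)) ?mulrA // => B.
by rewrite /= symdiff_eq.
Qed.

Lemma cmulA : associative (cmul eta).
Proof.
move=> U V W; apply/ffunP => D; rewrite !cmulE.
under eq_bigr => A _ do rewrite cmulE mulr_sumr mulr_suml.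
under [RHS]eq_bigr => C _ do rewrite cmulE !mulr_suml.
rewrite [RHS]exchange_big; apply: eq_bigr => A _ /=.
(* The left sum runs over the blade of [V], the right one over the blade [C] of [U * V]; the former
   becomes [symdiff A C], and the cocycle identity then matches the terms. *)
rewrite (reindex_inj (inv_inj (symdiffKl A))); apply: eq_bigr => C _ /=.
have -> : symdiff (symdiff A C) (symdiff A D) = symdiff C D.
  by rewrite (symdiffC A C) symdiffA -(symdiffA C) symdiffv symdiffs0.
have := blade_coef_cocycle A (symdiff A C) (symdiff C D).
rewrite symdiffKl.
have -> : symdiff (symdiff A C) (symdiff C D) = symdiff A D.
  by rewrite symdiffA -(symdiffA A) symdiffv symdiffs0.
move: (blade_coef A (symdiff A C)) (blade_coef C _) (blade_coef A (symdiff A D))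
  (blade_coef (symdiff A C) _) => p q r s cocycle.
by rewrite -mulrA -[_ * s * r]mulrA (mulrC s) -cocycle -!mulrA
  (mulrCA (W _)).
Qed.

Lemma cmul1l : left_id (cone K n) (cmul eta).
Proof.
move=> U; apply/ffunP => C; rewrite cmulE (bigD1 set0) //= big1 => [|A A0].
  by rewrite ffunE eqxx mul1r addr0 symdiff0s blade_coef0s mulr1.
by rewrite ffunE (negPf A0) !mul0r.
Qed.

Lemma cmul1r : right_id (cone K n) (cmul eta).
Proof.
move=> U; apply/ffunP => C; rewrite cmulE (bigD1 C) //= big1 => [|A AC].
  by rewrite ffunE symdiffv eqxx mulr1 addr0 blade_coefs0 mulr1.
by rewrite ffunE symdiff_eq symdiffs0 eq_sym (negPf AC) mulr0 mul0r.
Qed.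

Lemma cmulDl : left_distributive (cmul eta) +%R.
Proof.
move=> U V W; apply/ffunP => C; rewrite [RHS]ffunE !cmulE -big_split.
by apply: eq_bigr => A _; rewrite /= ffunE !mulrDl.
Qed.

Lemma cmulDr : right_distributive (cmul eta) +%R.
Proof.
move=> U V W; apply/ffunP => C; rewrite [RHS]ffunE !cmulE -big_split.
by apply: eq_bigr => A _; rewrite /= ffunE mulrDr !mulrDl.
Qed.

Lemma cone_neq0 : cone K n != 0.
Proof. by apply/eqP => /ffunP/(_ set0)/eqP; rewrite !ffunE eqxx oner_eq0. Qed.

End StructureConstants.

(* The type records [eta] so that the Clifford product can be its canonical
   multiplication; finite functions already carry the pointwise one. *)
Definition cliff (K : fieldType) (n : nat) (eta : 'I_n -> K) : Type := clif K n.

(** * The [K]-algebra structure *)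

Section CliffordRing.
Variables (K : fieldType) (n : nat) (eta : 'I_n -> K).

HB.instance Definition _ :=
  GRing.Lmodule.copy (cliff eta) {ffun {set 'I_n} -> K^o}.
HB.instance Definition _ := GRing.Zmodule_isNzRing.Build (cliff eta)
  (cmulA eta) (cmul1l eta) (cmul1r eta) (cmulDl eta) (cmulDr eta) (cone_neq0 K n).

Implicit Types (U V : cliff eta) (A B C : {set 'I_n}).

Lemma cliff_mulE U V C : (U * V) C =
  \sum_A U A * V (symdiff A C) * blade_coef eta A (symdiff A C).
Proof. exact: cmulE. Qed.

Lemma cliff_addE U V C : (U + V) C = U C + V C. Proof. exact: ffunE. Qed.
Lemma cliff_oppE U C : (- U) C = - U C. Proof. exact: ffunE. Qed.
Lemma cliff_scaleE (a : K) U C : (a *: U) C = a * U C. Proof. exact: ffunE. Qed.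
Lemma cliff_oneE C : (1 : cliff eta) C = (C == set0)%:R.
Proof. by rewrite ffunE; case: eqP. Qed.

Fact cliff_scaleAl (a : K) U V : a *: (U * V) = (a *: U) * V.
Proof.
apply/ffunP => C; rewrite cliff_scaleE !cliff_mulE mulr_sumr.
by apply: eq_bigr => A _; rewrite cliff_scaleE !mulrA.
Qed.
HB.instance Definition _ := GRing.Lmodule_isLalgebra.Build K (cliff eta) cliff_scaleAl.

Fact cliff_scaleAr (a : K) U V : a *: (U * V) = U * (a *: V).
Proof.
apply/ffunP => C; rewrite cliff_scaleE !cliff_mulE mulr_sumr.
by apply: eq_bigr => A _; rewrite cliff_scaleE !mulrA (mulrC a).
Qed.
HB.instance Definition _ := GRing.Lalgebra_isAlgebra.Build K (cliff eta) cliff_scaleAr.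

End CliffordRing.

(** * Reversion, grade involution and blades *)

Section Involutions.
Variables (K : fieldType) (n : nat) (eta : 'I_n -> K).
Implicit Types (U V X : cliff eta) (A B C : {set 'I_n}).

(** Indexing by the blade of the right factor puts the terms of [U * X] and [X * U] with the same
    two coordinates at the same index. *)
Lemma cliff_mulE_swap U X C : (U * X) C =
  \sum_A X A * U (symdiff A C) * blade_coef eta (symdiff A C) A.
Proof.
rewrite cliff_mulE (reindex_inj (inv_inj (symdiffKl C))); apply: eq_bigr => A _ /=.
by rewrite [symdiff (symdiff C A) C]symdiffC symdiffKl (symdiffC C A)
  [U _ * _]mulrC.
Qed.

Lemma bin2D x y : 'C(x + y, 2) = ('C(x, 2) + 'C(y, 2) + x * y)%N.
Proof.
elim: x => [|x IHx]; first by rewrite add0n mul0n addn0.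
by rewrite addSn !binS IHx !bin1 mulSn; lia.
Qed.

Lemma odd_bin2_mul4 q : odd 'C(q * 4, 2) = false.
Proof. by elim: q => // q IHq; rewrite mulSn bin2D 2!oddD IHq oddM. Qed.

(** These parities are the two binary digits of the residue modulo 4, and also the exponents of the
    signs by which [reversion] and [ginv] act in grade [m]. *)
Lemma modn4_eq m k : (k < 4)%N ->
  (m %% 4 == k)%N = (odd 'C(m, 2) == odd 'C(k, 2)) && (odd m == odd k).
Proof.
rewrite {2 3}(divn_eq m 4) bin2D !oddD odd_bin2_mul4 !oddM !andbF /= addbF.
by have := ltn_pmod m (isT : 0 < 4)%N; case: (m %% 4)%N => [|[|[|[|]]]] // _;
  case: k => [|[|[|[|]]]].
Qed.

(** The sign rule behind [reversionM]. All cardinals are expanded in those of [A :\: B], [B :\: A]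
    and [A :&: B]. *)
Lemma odd_bin2_symdiff A B : odd 'C(#|symdiff A B|, 2) (+) comm_sign A B =
  odd 'C(#|A|, 2) (+) odd 'C(#|B|, 2).
Proof.
rewrite /comm_sign card_symdiff -(cardsID B A) -(cardsID A B) (setIC B A).
rewrite !bin2D !oddD !oddM !oddD.
by case: (odd #|_|); case: (odd #|_|); case: (odd #|_|); do 3!case: (odd _).
Qed.

Definition reversion U : cliff eta := crev U.
Definition ginv U : cliff eta := [ffun A : {set 'I_n} => (-1) ^+ #|A| * U A].

Lemma reversionE U A : reversion U A = (-1) ^+ 'C(#|A|, 2) * U A. Proof. exact: ffunE. Qed.
Lemma ginvE U A : ginv U A = (-1) ^+ #|A| * U A. Proof. exact: ffunE. Qed.

Lemma reversionK : involutive reversion.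
Proof. by move=> U; apply/ffunP => A; rewrite !reversionE signrMK. Qed.

Lemma ginvK : involutive ginv.
Proof. by move=> U; apply/ffunP => A; rewrite !ginvE signrMK. Qed.

Lemma reversion_ginv U : reversion (ginv U) = ginv (reversion U).
Proof. by apply/ffunP => A; rewrite reversionE !ginvE reversionE mulrCA. Qed.

Lemma reversion1 : reversion 1 = 1.
Proof.
apply/ffunP => A; rewrite reversionE cliff_oneE; case: eqP => [->|_]; last by rewrite mulr0.
by rewrite cards0 mul1r.
Qed.

Lemma ginv1 : ginv 1 = 1.
Proof.
apply/ffunP => A; rewrite ginvE cliff_oneE; case: eqP => [->|_]; last by rewrite mulr0.
by rewrite cards0 mul1r.
Qed.

Lemma ginvM U V : ginv (U * V) = ginv U * ginv V.
Proof.
apply/ffunP => C; rewrite ginvE !cliff_mulE mulr_sumr; apply: eq_bigr => A _.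
rewrite !ginvE; set B := symdiff A C.
have -> : (-1) ^+ #|C| = (-1) ^+ #|A| * (-1) ^+ #|B| :> K.
  rewrite -[C](symdiffKl A) -/B -!(signr_odd _ #|_|) -signr_addb.
  by rewrite -odd_card_symdiff.
by rewrite mulrA; congr (_ * _); rewrite mulrACA.
Qed.

Lemma reversionM U V : reversion (U * V) = reversion V * reversion U.
Proof.
apply/ffunP => C; rewrite reversionE cliff_mulE cliff_mulE_swap mulr_sumr; apply: eq_bigr => A _.
rewrite !reversionE (blade_coefC eta A); set B := symdiff A C.
have -> : (-1) ^+ 'C(#|C|, 2) = (-1) ^+ 'C(#|A|, 2) * (-1) ^+ 'C(#|B|, 2)
            * (-1) ^+ comm_sign A B :> K.
  rewrite -[C](symdiffKl A) -/B -!(signr_odd _ 'C(_, _)) -!signr_addb.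
  by rewrite -odd_bin2_symdiff addbK.
by rewrite mulrACA signrMK; congr (_ * _); rewrite mulrACA.
Qed.

Definition blade B : cliff eta := [ffun A => (A == B)%:R].

Lemma bladeE B A : blade B A = (A == B)%:R. Proof. exact: ffunE. Qed.

Lemma mul_bladeE X B C :
  (X * blade B) C = X (symdiff B C) * blade_coef eta (symdiff B C) B.
Proof.
rewrite cliff_mulE (bigD1 (symdiff B C)) //= big1 => [|A AC].
  by rewrite [symdiff (symdiff B C) C]symdiffC (symdiffC B C) symdiffKl bladeE
    eqxx mulr1 addr0.
by rewrite bladeE symdiffC symdiff_eq (symdiffC C) (negPf AC) mulr0 mul0r.
Qed.

Lemma blade_mulE X B C :
  (blade B * X) C = X (symdiff B C) * blade_coef eta B (symdiff B C).
Proof.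
rewrite cliff_mulE (bigD1 B) //= big1 => [|A AC]; first by rewrite bladeE eqxx mul1r addr0.
by rewrite bladeE (negPf AC) !mul0r.
Qed.

Lemma blade_sqr B : blade B * blade B = blade_coef eta B B *: 1.
Proof.
apply/ffunP => C; rewrite mul_bladeE cliff_scaleE cliff_oneE bladeE symdiff_eq symdiffv.
by case: eqP => [->|_]; rewrite ?mul0r ?mulr0 // symdiffs0 mulrC.
Qed.

Lemma ginv_blade B : ginv (blade B) = (-1) ^+ #|B| *: blade B.
Proof.
apply/ffunP => A; rewrite ginvE cliff_scaleE bladeE.
by case: eqP => [->|_] //; rewrite !mulr0.
Qed.

(** Commuting blades give equal terms in both products, and by assumption an anticommuting pair has
    a zero coefficient. *)
Lemma commute_support X U :
  (forall A B, comm_sign A B -> X A = 0 \/ U B = 0) -> X * U = U * X.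
Proof.
move=> XU; apply/ffunP => C; rewrite cliff_mulE cliff_mulE_swap; apply: eq_bigr => A _.
rewrite (blade_coefC eta A); have := XU A (symdiff A C).
case: (comm_sign _ _) => [/(_ isT) [] -> | _]; rewrite ?(mulr0, mul0r) //.
by rewrite mul1r.
Qed.

End Involutions.

(** * Centralizers of the subspaces of given residue modulo 4 *)

Section Centralizers.
Variables (K : fieldType) (n : nat) (eta : 'I_n -> K).
Hypotheses (two_neq0 : (2 : K) != 0) (eta_neq0 : forall i, eta i != 0).
Implicit Types (U V X T : cliff eta) (A B C : {set 'I_n}).

Lemma sign_eq_neq0 (b c : bool) (x : K) :
  (-1) ^+ b * x = (-1) ^+ c * x -> x != 0 -> b = c.
Proof.
move=> bc x0; move/(mulIf x0): bc; case: b; case: c => //= /esym/eqP.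
  by rewrite -addr_eq0 (negPf two_neq0).
by rewrite eq_sym -addr_eq0 (negPf two_neq0).
Qed.

Lemma blade_coef_neq0 A B : blade_coef eta A B != 0.
Proof.
rewrite mulf_neq0 //; first by rewrite /csign signr_eq0.
by rewrite prodf_seq_neq0; apply/allP => i _; rewrite eta_neq0 implybT.
Qed.

Lemma grade_mod4P k U : (k < 4)%N ->
  grade_mod4 k U <-> reversion U = (-1) ^+ 'C(k, 2) *: U /\ ginv U = (-1) ^+ k *: U.
Proof.
move=> k4; split=> [Uk|[revU ginvU] A].
  split; apply/ffunP => A; rewrite ?reversionE ?ginvE cliff_scaleE;
    have [/eqP|/Uk->] := boolP (#|A| %% 4 == k)%N; rewrite ?mulr0 // => /eqP;
    rewrite modn4_eq // => /andP[/eqP e2 /eqP e1].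
    by rewrite -signr_odd e2 signr_odd.
  by rewrite -signr_odd e1 signr_odd.
rewrite modn4_eq //; case: (eqVneq (U A) 0) => // UA /negP[].
have /sign_eq_neq0 -> // : (-1) ^+ odd 'C(#|A|, 2) * U A = (-1) ^+ odd 'C(k, 2) * U A.
  by rewrite !signr_odd -reversionE revU cliff_scaleE.
have /sign_eq_neq0 -> // : (-1) ^+ odd #|A| * U A = (-1) ^+ odd k * U A.
  by rewrite !signr_odd -ginvE ginvU cliff_scaleE.
by rewrite !eqxx.
Qed.

(** At the index [symdiff B A] each product has a single term, coming from [X A], and the two terms
    are opposite; so twice a nonzero multiple of [X A] vanishes. *)
Lemma commute_blade X B : X * blade eta B = blade eta B * X ->
  forall A, comm_sign A B -> X A = 0.
Proof.
move=> XB A AB; have := congr1 (fun Y : cliff eta => Y (symdiff B A)) XB.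
rewrite mul_bladeE blade_mulE symdiffKl (blade_coefC eta A) AB expr1 mulN1r mulrN.
move/eqP; rewrite eq_sym -addr_eq0 -mulr2n -mulr_natr mulf_eq0 (negPf two_neq0).
by rewrite orbF mulf_eq0 (negPf (blade_coef_neq0 _ _)) orbF => /eqP.
Qed.

Definition centralizes k X := forall U, grade_mod4 k U -> X * U = U * X.

Lemma centralizesP k X : centralizes k X <->
  forall A B, (#|B| %% 4)%N = k -> comm_sign A B -> X A = 0.
Proof.
split=> [Xk A B Bk|Xk U Uk].
  apply: commute_blade; apply: Xk => C; rewrite bladeE.
  by case: (eqVneq C B) => [->|//]; rewrite Bk eqxx.
apply: commute_support => A B AB.
have [/eqP Bk|/Uk] := boolP (#|B| %% 4 == k)%N; last by right.
by left; apply: Xk AB.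
Qed.

Lemma exists_subset_card (A : {set 'I_n}) m : (m <= #|A|)%N ->
  exists2 B : {set 'I_n}, B \subset A & #|B| = m.
Proof.
move=> mA; exists [set x in take m (enum A)].
  by apply/subsetP => x; rewrite inE => /mem_take; rewrite mem_enum.
rewrite cardsE (card_uniqP _) ?take_uniq ?enum_uniq //.
by rewrite size_takel // -cardE.
Qed.

(* Exchanging one element of [B] changes the parity of [#|A :&: B|]. *)
Lemma comm_sign_fixed_card m A : (0 < m < n)%N -> A != set0 -> A != [set: 'I_n] ->
  exists2 B : {set 'I_n}, #|B| = m & comm_sign A B.
Proof.
case: m => // m /andP[_ mn] /set0Pn[a aA]; rewrite eqEsubset subsetT /=.
move=> /subsetPn[b _ bA].
have ab : a != b by apply: contraNneq bA => <-.
have [|B /subsetP sB cB] := @exists_subset_card (~: [set a; b]) m.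
  have := cardsC [set a; b]; rewrite cards2 ab card_ord; lia.
have aB : a \notin B by apply/negP => /sB; rewrite !inE eqxx.
have bB : b \notin B by apply/negP => /sB; rewrite !inE eqxx orbT.
case ABa: (comm_sign A (a |: B)); first by exists (a |: B); rewrite ?cardsU1 ?aB ?cB.
exists (b |: B); first by rewrite cardsU1 bB cB.
move: ABa; rewrite /comm_sign !cardsU1 aB bB !setIUr.
have -> : A :&: [set a] = [set a].
  by apply/setP => x; rewrite !inE; case: eqP => [->|]; rewrite ?aA ?andbF.
have -> : A :&: [set b] = set0.
  by apply/setP => x; rewrite !inE; case: eqP => [->|]; rewrite ?(negPf bA) ?andbF.
rewrite set0U cardsU1 inE (negPf aB) andbF !oddD => /=.
by do 2!case: (odd _).
Qed.

Lemma comm_sign0s B : comm_sign set0 B = false.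
Proof. by rewrite /comm_sign cards0 mul0n set0I cards0. Qed.

Lemma comm_signTs B : comm_sign [set: 'I_n] B = ~~ odd n && odd #|B|.
Proof.
by rewrite /comm_sign setTI cardsT card_ord oddD oddM; case: (odd n); case: (odd _).
Qed.

(** For a proper nonempty [A] an anticommuting blade of grade [k] exists by exchange; the full blade
    anticommutes with every odd blade when [n] is even and is central when [n] is odd. *)
Lemma centralizes_center k X : odd k -> (k < 4)%N -> (k < n)%N ->
  centralizes k X <-> center X.
Proof.
move=> ok k4 kn; split=> [/centralizesP Xk A A0 AT|cX].
  have k0 : (0 < k < n)%N by rewrite kn andbT; case: (k) ok.
  have [AT'|AT'] := eqVneq A [set: 'I_n].
    have [|B _ cB] := @exists_subset_card [set: 'I_n] k.
      by rewrite cardsT card_ord ltnW.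
    apply: (Xk _ B); first by rewrite cB modn_small.
    case: AT => [on|]; last by rewrite AT' eqxx.
    by rewrite AT' comm_signTs on cB.
  have [B cB AB] := comm_sign_fixed_card k0 A0 AT'.
  by apply: Xk AB; rewrite cB modn_small.
apply/centralizesP => A B _ AB; apply: cX.
  by apply: contraTneq AB => ->; rewrite comm_sign0s.
case: (boolP (odd n)) => on; [right|by left].
by apply: contraTneq AB => ->; rewrite comm_signTs on.
Qed.

(** The residue is presented through a grade [m] strictly between 0 and [n], where the exchange
    argument applies; residue 0 is thus reached at [m = 4] once [n > 4]. Even blades always commute
    with the full blade. *)
Lemma centralizes_grade0n m X : ~~ odd m -> (0 < m < n)%N ->
  centralizes (m %% 4)%N X <-> grade0n X.
Proof.
move=> om mn; split=> [/centralizesP Xk A A0 AT|cX].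
  have [B cB AB] := comm_sign_fixed_card mn A0 AT.
  by apply: Xk AB; rewrite cB.
apply/centralizesP => A B cB AB; apply: cX.
  by apply: contraTneq AB => ->; rewrite comm_sign0s.
apply: contraTneq AB => ->; rewrite comm_signTs.
by rewrite -(odd_mod #|B| (d := 4)) // cB odd_mod // (negPf om) andbF.
Qed.

(** The only blade of grade 2 is the full one, which anticommutes with both generators. *)
Lemma centralizes_grade0n_n2 X : n = 2 -> centralizes 2 X <-> grade0n X.
Proof.
move=> n2; have cT : #|[set: 'I_n]| = 2 by rewrite cardsT card_ord.
split=> [/centralizesP Xk A A0 AT|cX].
  apply: (Xk A [set: 'I_n]); first by rewrite cT.
  have := proper_card (_ : A \proper [set: 'I_n]); rewrite properT => /(_ AT).
  move: A0; rewrite /comm_sign cT setIT -card_gt0.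
  by case: #|A| => [|[|]].
apply/centralizesP => A B cB AB; apply: cX.
  by apply: contraTneq AB => ->; rewrite comm_sign0s.
apply: contraTneq AB => ->; rewrite comm_signTs.
by rewrite -(odd_mod #|B| (d := 4)) // cB andbF.
Qed.

(** Links the coordinate description of the center with the algebraic one; commuting with the
    subspace of residue 1 already suffices. *)
Lemma centerP X : (1 < n)%N -> center X <-> forall Y, X * Y = Y * X.
Proof.
move=> n1; split=> [cX Y|XC]; last first.
  by apply/(@centralizes_center 1) => // U _; apply: XC.
apply: commute_support => A B AB; left; apply: cX.
  by apply: contraTneq AB => ->; rewrite comm_sign0s.
case: (boolP (odd n)) => on; [right|by left].
by apply: contraTneq AB => ->; rewrite comm_signTs on.
Qed.

Lemma center_grade0n X : center X -> grade0n X.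
Proof. by move=> cX A A0 AT; apply: cX => //; right. Qed.

Lemma grade0n_center X : odd n -> grade0n X -> center X.
Proof. by move=> on X0 A A0 [|]; [rewrite on|exact: X0]. Qed.

Lemma grade0nE X : (0 < n)%N -> grade0n X ->
  X = X set0 *: 1 + X [set: 'I_n] *: blade eta [set: 'I_n].
Proof.
move=> n0 X0; have T0 : [set: 'I_n] != set0 by rewrite -card_gt0 cardsT card_ord.
apply/ffunP => A; rewrite cliff_addE !cliff_scaleE cliff_oneE bladeE.
have [->|A0] := eqVneq A set0; first by rewrite eq_sym (negPf T0) mulr1 mulr0 addr0.
have [->|AT] := eqVneq A [set: 'I_n]; first by rewrite mulr1 mulr0 add0r.
by rewrite !mulr0 addr0 X0.
Qed.

Lemma even_partP T : even_part T <-> ginv T = T.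
Proof.
split=> [eT|gT A oA].
  apply/ffunP => A; rewrite ginvE -signr_odd.
  by case: (boolP (odd _)) => [/eT->|]; rewrite ?mulr0 ?mul1r.
apply/eqP/negP => /negP TA; have := congr1 (fun Y : cliff eta => Y A) gT.
by rewrite ginvE -signr_odd oA -[RHS]mul1r => /(@sign_eq_neq0 true false)/(_ TA).
Qed.

Lemma odd_partP T : odd_part T <-> ginv T = - T.
Proof.
split=> [eT|gT A oA].
  apply/ffunP => A; rewrite ginvE cliff_oppE -signr_odd.
  by case: (boolP (odd _)) => [|/eT->]; rewrite ?mulr0 ?mulN1r ?oppr0.
apply/eqP/negP => /negP TA; have := congr1 (fun Y : cliff eta => Y A) gT.
rewrite ginvE cliff_oppE -signr_odd (negPf oA) -[RHS]mulN1r.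
by move=> /(@sign_eq_neq0 false true)/(_ TA).
Qed.

End Centralizers.

(** Two conjugations agree at [u] when their quotient commutes with [u]; this converts eigenvector
    conditions on a conjugate into centralizer conditions. *)
Lemma conj_eq_commute (R : pzRingType) (x x' y y' u : R) :
  x * x' = 1 -> x' * x = 1 -> y * y' = 1 -> y' * y = 1 ->
  x * u * x' = y * u * y' <-> y' * x * u = u * (y' * x).
Proof.
move=> xx' x'x yy' y'y; split=> [xuy|xuy].
  have := congr1 (fun z => y' * z * x) xuy.
  by rewrite !mulrA y'y mul1r -[_ * x' * x]mulrA x'x mulr1 -mulrA.
have := congr1 (fun z => y * z * x') xuy.
by rewrite !mulrA yy' mul1r -[_ * x * x']mulrA xx' mulr1.
Qed.

(** * Units, and the pseudoscalar for even [n] *)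

Section Units.
Variables (K : fieldType) (n : nat) (eta : 'I_n -> K).
Implicit Types (U V X T : cliff eta).

Lemma cunitP T : cunit eta T <-> exists Ti : cliff eta, T * Ti = 1 /\ Ti * T = 1.
Proof. by []. Qed.

Lemma cunitM U V : cunit eta U -> cunit eta V -> cunit eta (U * V).
Proof.
move=> /cunitP[Ui [U1 U2]] /cunitP[Vi [V1 V2]]; apply/cunitP.
exists (Vi * Ui); split.
  by rewrite mulrA -(mulrA U) V1 mulr1.
by rewrite mulrA -(mulrA Vi) U2 mulr1.
Qed.

Lemma cunit1 : cunit eta (1 : cliff eta).
Proof. by apply/cunitP; exists 1; rewrite mulr1. Qed.

Lemma cunit_rev T : cunit eta T -> cunit eta (reversion T).
Proof.
move=> /cunitP[Ti [T1 T2]]; apply/cunitP; exists (reversion Ti).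
by rewrite -!reversionM T1 T2 reversion1.
Qed.

Lemma cunit_revM T : cunit eta T -> cunit eta (reversion T * T).
Proof. by move=> Tu; apply: cunitM => //; apply: cunit_rev. Qed.

Lemma reversionZ (a : K) U : reversion (a *: U) = a *: reversion U.
Proof. by apply/ffunP => A; rewrite reversionE !cliff_scaleE reversionE mulrCA. Qed.

Lemma ginvD U V : ginv (U + V) = ginv U + ginv V.
Proof. by apply/ffunP => A; rewrite cliff_addE !ginvE cliff_addE mulrDr. Qed.

Lemma ginvZ (a : K) U : ginv (a *: U) = a *: ginv U.
Proof. by apply/ffunP => A; rewrite ginvE !cliff_scaleE ginvE mulrCA. Qed.

Lemma pseudoscalar_commute T : ~~ odd n ->
  blade eta [set: 'I_n] * T = ginv T * blade eta [set: 'I_n].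
Proof.
move=> en; apply/ffunP => C; rewrite blade_mulE mul_bladeE ginvE.
by rewrite blade_coefC comm_signTs en /= signr_odd mulrCA mulrA.
Qed.

End Units.

(** * The center and a commutation criterion for [Gamma] *)

Section Groups.
Variables (K : fieldType) (n : nat) (eta : 'I_n -> K).
Hypotheses (two_neq0 : (2 : K) != 0) (eta_neq0 : forall i, eta i != 0).
Hypothesis (n_gt1 : (1 < n)%N).
Implicit Types (U V X T S W E : cliff eta) (A B C : {set 'I_n}).

Local Notation omega := (blade eta [set: 'I_n]).

Let n_gt0 : (0 < n)%N. Proof. exact: ltnW. Qed.

Lemma setT_neq0 : [set: 'I_n] != set0.
Proof. by rewrite -card_gt0 cardsT card_ord. Qed.

Lemma center1 : center (1 : cliff eta).
Proof. by move=> A A0 _; rewrite cliff_oneE (negPf A0). Qed.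

Lemma centerM X U : center X -> center U -> center (X * U).
Proof.
move=> /(centerP two_neq0 eta_neq0 _ n_gt1) cX /(centerP two_neq0 eta_neq0 _ n_gt1) cU.
by apply/(centerP two_neq0 eta_neq0) => // Y; rewrite -mulrA cU mulrA cX mulrA.
Qed.

Lemma centerZ (a : K) X : center X -> center (a *: X).
Proof. by move=> cX A A0 AT; rewrite cliff_scaleE cX // mulr0. Qed.

Lemma center_rev X : center X -> center (reversion X).
Proof. by move=> cX A A0 AT; rewrite reversionE cX // mulr0. Qed.

Lemma center_ginv X : center X -> center (ginv X).
Proof. by move=> cX A A0 AT; rewrite ginvE cX // mulr0. Qed.

Lemma center_comm X U : center X -> X * U = U * X.
Proof. by move=> /(centerP two_neq0 eta_neq0 _ n_gt1) ->. Qed.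

Lemma center_inv X U : X * U = 1 -> center X -> center U.
Proof.
move=> XU /(centerP two_neq0 eta_neq0 _ n_gt1) cX.
apply/(centerP two_neq0 eta_neq0) => // Y.
have UX : U * X = 1 by rewrite -cX.
by rewrite -[LHS]mulr1 -XU -mulrA (mulrA Y) -(cX Y) !mulrA UX mul1r.
Qed.

(** Up to the eigenvalue of [U], applying [reversion] or [ginv] to [T * U * Ti] gives the conjugate
    of [U] by the inverse of [reversion T], respectively by [ginv T]. Each eigenvector condition
    therefore equates two conjugates of [U]. *)
Lemma conj_grade_mod4 k T Ti U : (k < 4)%N -> T * Ti = 1 -> Ti * T = 1 ->
  grade_mod4 k U -> grade_mod4 k (T * U * Ti) <->
  reversion T * T * U = U * (reversion T * T) /\ Ti * ginv T * U = U * (Ti * ginv T).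
Proof.
move=> k4 T1 T2 /(grade_mod4P two_neq0 _ k4)[revU ginvU].
have R1 : reversion Ti * reversion T = 1 by rewrite -reversionM T1 reversion1.
have R2 : reversion T * reversion Ti = 1 by rewrite -reversionM T2 reversion1.
have G1 : ginv T * ginv Ti = 1 by rewrite -ginvM T1 ginv1.
have G2 : ginv Ti * ginv T = 1 by rewrite -ginvM T2 ginv1.
rewrite -(conj_eq_commute U T1 T2 R1 R2) -(conj_eq_commute U G1 G2 T1 T2).
rewrite (grade_mod4P two_neq0) // !reversionM !ginvM revU ginvU.
rewrite -!(scalerAl, scalerAr) mulrA.
have sg m : (-1) ^+ m != 0 :> K by rewrite signr_eq0.
by split=> [[/(scalerI (sg _)) -> /(scalerI (sg _)) ->] | [-> ->]].
Qed.

Lemma GammaP k T : (k < 4)%N -> Gamma eta k T <-> exists Ti,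
  [/\ T * Ti = 1, Ti * T = 1, centralizes k (reversion T * T)
    & centralizes k (Ti * ginv T)].
Proof.
move=> k4; split=> [[/cunitP[Ti [T1 T2]] pT]|[Ti [T1 T2 cR cG]]].
  by exists Ti; split=> // U Uk;
    have [] := (conj_grade_mod4 k4 T1 T2 Uk).1 (pT _ T1 T2 _ Uk).
split=> [|Ti' T1' _ U Uk]; first by apply/cunitP; exists Ti.
have -> : Ti' = Ti by rewrite -[RHS]mulr1 -(T1' : T * Ti' = 1) mulrA T2 mul1r.
by apply/(conj_grade_mod4 k4 T1 T2 Uk); split; [apply: cR|apply: cG].
Qed.

(** * Parity of units and the group P *)

(** Write [S] as a + b omega. Applying [ginv] twice gives S^2 = 1, whose top coefficient yields 2ab
    = 0. If b = 0 then a is 1 or -1, which is the parity. If a = 0, moving omega past [T] and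
    cancelling [ginv T] leaves 1 = b omega, which is absurd. *)
Lemma even_or_odd_left S T : ~~ odd n -> grade0n S -> cunit eta T ->
  ginv T = S * T -> even_part T \/ odd_part T.
Proof.
move=> en S0 /cunitP[Ti [T1 T2]] TS.
have SE := grade0nE n_gt0 S0.
set a := S set0 in SE; set b := S _ in SE.
have ginvS : ginv S = S.
  apply/(even_partP two_neq0) => A oA; apply: S0; apply: contraTneq oA => ->.
    by rewrite cards0.
  by rewrite cardsT card_ord.
have SS : S * S = 1.
  have /(congr1 (fun Y => Y * Ti)) : S * S * T = T.
    by rewrite -mulrA -TS -{1}ginvS -ginvM -TS ginvK.
  by rewrite -mulrA T1 mulr1.
have SX X : S * X = a *: X + b *: (omega * X).
  by rewrite {1}SE mulrDl -!scalerAl mul1r.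
have ab : a * b = 0.
  have := congr1 (fun Y : cliff eta => Y [set: 'I_n]) SS.
  rewrite SX cliff_addE !cliff_scaleE cliff_oneE (negPf setT_neq0) blade_mulE symdiffv blade_coefs0.
  rewrite mulr0n mulr1 -/a -/b (mulrC b) -mulr2n -[_ *+ 2]mulr_natr => /eqP.
  by rewrite mulf_eq0 (negPf two_neq0) orbF => /eqP.
have [b0|b0] := eqVneq b 0.
  have {}SX X : S * X = a *: X by rewrite SX b0 scale0r addr0.
  have aa : a * a = 1.
    have := congr1 (fun Y : cliff eta => Y set0) SS.
    by rewrite SX cliff_scaleE cliff_oneE eqxx.
  have /eqP : a ^+ 2 = 1 ^+ 2 by rewrite expr2 aa expr1n.
  move: TS; rewrite SX => TS; rewrite eqf_sqr => /orP[]/eqP a1.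
    by left; apply/(even_partP two_neq0); rewrite TS a1 scale1r.
  by right; apply/(odd_partP two_neq0); rewrite TS a1 scaleN1r.
have a0 : a = 0 by move/eqP: ab; rewrite mulf_eq0 (negPf b0) orbF => /eqP.
move: TS; rewrite SX a0 scale0r add0r pseudoscalar_commute // => TS.
have /(congr1 (fun Y => ginv Ti * Y)) := TS.
rewrite -scalerAr mulrA -ginvM T2 ginv1 mul1r.
move=> /(congr1 (fun Y : cliff eta => Y set0))/eqP.
by rewrite cliff_oneE eqxx cliff_scaleE bladeE [set0 == _]eq_sym (negPf setT_neq0) mulr0 oner_eq0.
Qed.

(** Reversion commutes with [ginv], preserves parity and moves the factor [S] to the other side. *)
Lemma even_or_odd_right S T : ~~ odd n -> grade0n S -> cunit eta T ->
  ginv T = T * S -> even_part T \/ odd_part T.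
Proof.
move=> en S0 Tu TS.
have S0' : grade0n (reversion S) by move=> A A0 AT; rewrite reversionE S0 // mulr0.
have [] := @even_or_odd_left (reversion S) (reversion T) en S0' (cunit_rev Tu).
- by rewrite -reversionM -TS reversion_ginv.
- by move=> eT; left=> A /eT; rewrite reversionE => /eqP; rewrite mulf_eq0 signr_eq0 => /eqP.
- by move=> oT; right=> A /oT; rewrite reversionE => /eqP; rewrite mulf_eq0 signr_eq0 => /eqP.
Qed.

Lemma ginv_even_or_odd E : evenodd_units eta E ->
  cunit eta E /\ exists b : bool, ginv E = (-1) ^+ b *: E.
Proof.
move=> [[/(even_partP two_neq0) gE Eu]|[/(odd_partP two_neq0) gE Eu]]; split=> //.
  by exists false; rewrite scale1r.
by exists true; rewrite scaleN1r.
Qed.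

Lemma PgrpP T : Pgrp eta T <-> exists W E : cliff eta,
  [/\ units_in eta (@center K n) W, evenodd_units eta E & T = W * E].
Proof.
split=> [[W [E [uW [uE TE]]]]|[W [E [uW uE TE]]]]; first by exists W, E.
by exists W, E; split; [exact: uW|split; [exact: uE|exact: TE]].
Qed.

(** For T = W E with ginv(E) = (-1)^b E, the central factor is (-1)^b W^-1 ginv(W). *)
Lemma Pgrp_ginv T : Pgrp eta T ->
  cunit eta T /\ exists S, center S /\ ginv T = T * S.
Proof.
move=> /PgrpP[W [E [[cW Wu] /ginv_even_or_odd[Eu [b gE]] ->]]].
split; first exact: cunitM.
have /cunitP[Wi [W1 W2]] := Wu.
have cWi := center_inv W1 cW.
exists ((-1) ^+ b *: (Wi * ginv W)); split.
  by apply: centerZ; apply: centerM => //; apply: center_ginv.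
rewrite ginvM gE -!scalerAr; congr (_ *: _).
rewrite (center_comm E cW) mulrA -[E * W * Wi]mulrA W1 mulr1.
by rewrite center_comm //; apply: center_ginv.
Qed.

Lemma Pgrp_even_n T : ~~ odd n -> Pgrp eta T <-> evenodd_units eta T.
Proof.
move=> en; split=> [PT|uT]; last first.
  by apply/PgrpP; exists 1, T; split; rewrite ?mul1r //; split;
    [exact: center1|exact: cunit1].
have [Tu [S [cS TS]]] := Pgrp_ginv PT.
by have [] := even_or_odd_right en (center_grade0n cS) Tu TS; [left|right].
Qed.

(* Hilbert 90 for the involution of the center: from [S * ginv S = 1] one gets
   [S = +- ginv W / W] with [W = 1 +- ginv S], whose norm is [2 +- 2 * S set0]. *)
Lemma Pgrp_odd_n S T : odd n -> center S -> cunit eta T ->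
  ginv T = T * S -> Pgrp eta T.
Proof.
move=> on cS /cunitP[Ti [T1 T2]] TS.
have SS : S * ginv S = 1.
  have /(congr1 (fun Y => Ti * Y)) : T * (S * ginv S) = T.
    by rewrite mulrA -TS -ginvM -TS ginvK.
  by rewrite mulrA T2 mul1r.
set a := S set0.
have trS : S + ginv S = (a + a) *: 1.
  have cSg := center_ginv cS.
  apply/ffunP => A; rewrite cliff_addE cliff_scaleE cliff_oneE.
  have [->|A0] := eqVneq A set0; first by rewrite ginvE cards0 mul1r mulr1.
  rewrite mulr0; have [->|AT] := eqVneq A [set: 'I_n].
    by rewrite ginvE cardsT card_ord -signr_odd on mulN1r subrr.
  by rewrite ginvE cS ?mulr0 ?addr0 //; right.
have key (e c : K) : e * e = 1 -> c != 0 ->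
    (1 + e *: S) * (1 + e *: ginv S) = c *: 1 -> Pgrp eta T.
  move=> ee c0 eSS.
  have cW : center (c^-1 *: (1 + e *: ginv S)).
    apply: centerZ => A A0 AT.
    by rewrite cliff_addE cliff_scaleE (center_ginv cS) // mulr0 addr0 cliff_oneE (negPf A0).
  set W := c^-1 *: _ in cW.
  have SW : (1 + e *: S) * W = 1.
    by rewrite -scalerAr eSS scalerA mulVf // scale1r.
  have WS : W * (1 + e *: S) = 1 by rewrite center_comm.
  set E := T * (1 + e *: S).
  have Eu : cunit eta E.
    by apply: cunitM; apply/cunitP; [exists Ti|exists W].
  have gE : ginv E = e *: E.
    rewrite /E mulrDr mulr1 -scalerAr -TS.
    by rewrite ginvD ginvZ ginvK scalerDr scalerA ee scale1r addrC.
  have TE : T = W * E by rewrite center_comm // /E -mulrA SW mulr1.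
  apply/PgrpP; exists W, E; split=> //.
    by split=> //; apply/cunitP; exists (1 + e *: S).
  have : e ^+ 2 == 1 ^+ 2 by rewrite expr2 ee expr1n.
  rewrite eqf_sqr => /orP[]/eqP e1; [left|right]; split=> //.
    by apply/(even_partP two_neq0); rewrite gE e1 scale1r.
  by apply/(odd_partP two_neq0); rewrite gE e1 scaleN1r.
have prodE (e : K) : e * e = 1 ->
    (1 + e *: S) * (1 + e *: ginv S) = (2 + e * (a + a)) *: 1.
  move=> ee; rewrite mulrDl mul1r mulrDr mulr1 -scalerAl -scalerAr SS scalerA ee scale1r.
  rewrite (addrC (e *: S)) addrACA -scalerDr (addrC (ginv S)) trS scalerA scalerDl.
  by rewrite scaler_nat mulr2n.
(* The norms for the signs 1 and -1 add up to 4, so they do not both vanish. *)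
have [a1|a1] := eqVneq (2 + (a + a)) 0; last first.
  by apply: (key 1 _ _ a1); rewrite ?mulr1 // prodE ?mulr1 // mul1r.
apply: (key (-1) (2 + 2)); rewrite ?mulrNN ?mulr1 //.
  by rewrite -[2 + 2]/(2 *+ 2) -mulr_natr mulf_neq0.
rewrite prodE ?mulrNN ?mulr1 // mulN1r; congr (_ *: _); congr (_ + _).
by apply/esym/eqP; rewrite -addr_eq0 a1.
Qed.

(** * Identification of [Gamma] with Q and Q' *)

(** Treats Q and Q' together: [D] is the center or C^0 + C^n. Conversely, for [T] in P the element
    T^-1 ginv(T) is central, hence in [D], so only the condition on [reversion T * T] remains. *)
Lemma Gamma_Pgrp k (D : cliff eta -> Prop) T : (k < 4)%N ->
  (forall X, center X -> D X) -> (forall X, D X -> grade0n X) ->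
  (forall X, centralizes k X <-> D X) ->
  Gamma eta k T <-> Pgrp eta T /\ units_in eta D (reversion T * T).
Proof.
move=> k4 cD D0 kD; rewrite GammaP //; split.
  move=> [Ti [T1 T2 /kD DR /kD DG]].
  have Tu : cunit eta T by apply/cunitP; exists Ti.
  have TS : ginv T = T * (Ti * ginv T) by rewrite mulrA T1 mul1r.
  split; last by split=> //; apply: cunit_revM.
  case: (boolP (odd n)) => [on|en].
    by apply: Pgrp_odd_n TS => //; apply: grade0n_center => //; apply: D0.
  apply/(Pgrp_even_n _ en).
  by have [] := even_or_odd_right en (D0 _ DG) Tu TS; [left|right].
move=> [/Pgrp_ginv[/cunitP[Ti [T1 T2]] [S [cS TS]]] [DR _]].
exists Ti; split=> //; first exact/kD.
by apply/kD/cD; rewrite TS mulrA T2 mul1r.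
Qed.

Lemma Gamma_odd_Qgrp k T : odd k -> (k < 4)%N -> (k < n)%N ->
  Gamma eta k T <-> Qgrp eta T.
Proof.
move=> ok k4 kn; apply: (@Gamma_Pgrp k (@center K n)) => //.
  exact: center_grade0n.
by move=> X; apply: centralizes_center.
Qed.

Lemma Gamma_even_Q'grp m T : ~~ odd m -> (0 < m < n)%N ->
  Gamma eta (m %% 4) T <-> Q'grp eta T.
Proof.
move=> om mn; apply: (@Gamma_Pgrp _ (@grade0n K n)); rewrite ?ltn_pmod //.
  exact: center_grade0n.
by move=> X; apply: centralizes_grade0n.
Qed.

Lemma Gamma2_Q'grp T : Gamma eta 2 T <-> Q'grp eta T.
Proof.
move: n_gt1; rewrite leq_eqVlt => /orP[/eqP n2|n3]; last exact: (@Gamma_even_Q'grp 2).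
apply: (@Gamma_Pgrp 2 (@grade0n K n)) => //; first exact: center_grade0n.
by move=> X; apply: centralizes_grade0n_n2.
Qed.

(** The product is fixed by [reversion], and by [ginv] because the sign of [E] occurs twice. *)
Lemma rev_mul_grade_mod4 E : evenodd_units eta E -> grade_mod4 0 (reversion E * E).
Proof.
move=> /ginv_even_or_odd[_ [b gE]].
apply/(grade_mod4P two_neq0) => //; rewrite !scale1r reversionM reversionK ginvM -reversion_ginv gE.
by rewrite reversionZ -scalerAl -scalerAr scalerA -expr2 sqrr_sign scale1r.
Qed.

(** For odd [n] the two target spaces coincide. For even [n] elements of P have a parity, so
    [reversion T * T] lives in grades divisible by 4 and has no top component. *)
Lemma Q'grp_Qgrp T : (n %% 4)%N <> 0%N -> Q'grp eta T <-> Qgrp eta T.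
Proof.
move=> n4; split=> -[PT [RT Ru]]; split=> //; split=> //; last exact: center_grade0n.
case: (boolP (odd n)) => [on|en]; first exact: grade0n_center.
have /rev_mul_grade_mod4 R4 := (Pgrp_even_n T en).1 PT.
move=> A A0 _; have [->|AT] := eqVneq A [set: 'I_n]; last exact: RT.
by apply: R4; rewrite cardsT card_ord; apply/eqP.
Qed.

(** * Low dimensions, and P for odd [n] *)

Lemma grade_mod4_0_center X : (n < 4)%N -> grade_mod4 0 X -> center X.
Proof.
move=> n4 X0 A A0 _; apply: X0; rewrite modn_small -?lt0n ?card_gt0 //.
by apply: leq_ltn_trans n4; rewrite -[n in (_ <= n)%N]card_ord max_card.
Qed.

(** The central factor splits off as [reversion W * W]; the remaining [reversion E * E] lies in
    grades divisible by 4 and is a scalar below dimension 4. *)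
Lemma Pgrp_Qgrp T : (n < 4)%N -> Pgrp eta T -> Qgrp eta T.
Proof.
move=> n4 PT; split=> //; have [Tu _] := Pgrp_ginv PT.
split; last exact: cunit_revM.
have /PgrpP[W [E [[cW _] uE ->]]] := PT.
rewrite -[cmul _ _ _]/(reversion (W * E) * (W * E)).
have cWW : center (reversion W * W) by apply: centerM => //; apply: center_rev.
have -> : reversion (W * E) * (W * E) = reversion W * W * (reversion E * E).
  rewrite reversionM -mulrA (mulrA (reversion W)) mulrA -(center_comm _ cWW).
  by rewrite -mulrA.
apply: centerM => //.
by apply: grade_mod4_0_center => //; apply: rev_mul_grade_mod4.
Qed.

(** Conjugation fixes central elements. This serves residue 0 in dimensions 2 and 3, and residue 3
    in dimension 3. *)
Lemma Gamma_trivial k T : (forall U, grade_mod4 k U -> center U) ->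
  Gamma eta k T <-> cunit eta T.
Proof.
move=> kc; split=> [[]|Tu] //; split=> // Ti T1 T2 U Uk.
change (grade_mod4 k (T * U * Ti)); change (T * Ti = 1) in T1.
by rewrite -(center_comm T (kc _ Uk)) -mulrA T1 mulr1.
Qed.

(* In dimension 4 the centralizer of [C^0 + C^4] is the whole even part, so
   parity has to be read off the conjugate of the pseudoscalar,
   [T omega T^-1 = omega ginv(T) T^-1]. *)
Lemma Gamma0_n4 T : n = 4 -> Gamma eta 0 T <-> Q'grp eta T.
Proof.
move=> n4; have en : ~~ odd n by rewrite n4.
have cT : #|[set: 'I_n]| = 4 by rewrite cardsT card_ord.
have g0n U : grade_mod4 0 U -> grade0n U.
  move=> U0 A A0 AT; apply: U0.
  have := proper_card (_ : A \proper [set: 'I_n]); rewrite properT cT => /(_ AT) A4.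
  by rewrite modn_small // -lt0n card_gt0.
have omega0 : grade_mod4 0 omega.
  by move=> A; rewrite bladeE; case: (eqVneq A setT) => // ->; rewrite cT.
split.
  move=> [Tu pT]; have /cunitP[Ti [T1 T2]] := Tu.
  have Y0 := g0n _ (pT _ T1 T2 _ omega0).
  set Y : cliff eta := cmul _ _ _ in Y0.
  have YT : Y * T = omega * ginv T.
    by rewrite -[Y]/(T * omega * Ti) -mulrA T2 mulr1 pseudoscalar_commute ?ginvK.
  have e0 := blade_coef_neq0 eta_neq0 [set: 'I_n] [set: 'I_n].
  set ep := blade_coef _ _ _ in e0.
  have oo : omega * omega = ep *: 1 by rewrite blade_sqr.
  have S0 : grade0n (ep^-1 *: (omega * Y)).
    move=> A A0 AT; rewrite cliff_scaleE blade_mulE Y0 ?mul0r ?mulr0 //.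
      by apply: contraNneq AT => /(congr1 (symdiff setT)); rewrite symdiffKl symdiffs0 => ->.
    by apply: contraNneq A0 => /(congr1 (symdiff setT)); rewrite symdiffKl symdiffv => ->.
  have TS : ginv T = ep^-1 *: (omega * Y) * T.
    by rewrite -scalerAl -mulrA YT mulrA oo -scalerAl mul1r scalerA mulVf // scale1r.
  have eoT : evenodd_units eta T.
    by have [] := even_or_odd_left en S0 Tu TS; [left|right].
  split; first exact/Pgrp_even_n.
  split; last exact: cunit_revM.
  by apply: g0n; apply: rev_mul_grade_mod4.
move=> [/(Pgrp_even_n _ en) eoT [RT _]].
apply/GammaP => //; have [/cunitP[Ti [T1 T2]] [b gT]] := ginv_even_or_odd eoT.
(* In dimension 4 the subspace of residue 0 is spanned by 1 and omega, and both commute with even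
   elements. *)
have even0 X U : even_part X -> grade_mod4 0 U -> X * U = U * X.
  move=> eX U0; apply: commute_support => A B AB.
  have [B0|/U0] := boolP (#|B| %% 4 == 0)%N; last by right.
  left; apply: eX; move: AB; apply: contraTT => oA.
  have [->|BT] := eqVneq B setT; first by
    rewrite /comm_sign setIT cT oddD oddM andbF (negPf oA).
  have [->|BN] := eqVneq B set0; first by rewrite /comm_sign setI0 cards0 muln0.
  have := proper_card (_ : B \proper [set: 'I_n]); rewrite properT cT => /(_ BT) B4.
  by move: B0; rewrite modn_small // -[_ == _]negbK -lt0n card_gt0 BN.
exists Ti; split=> // U U0; apply: even0 => //.
  move=> A oA; apply: (rev_mul_grade_mod4 eoT).
  by apply: contraTneq oA => A4; rewrite -(odd_mod #|A| (d := 4)) // A4.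
rewrite gT -scalerAr T2 => A oA; rewrite cliff_scaleE cliff_oneE.
by case: eqP oA => [->|]; rewrite ?cards0 ?mulr0.
Qed.

(** The criterion for residue 1 makes both test elements central, and then they centralize every
    residue. *)
Lemma Gamma1_sub k T : (k < 4)%N -> Gamma eta 1 T -> Gamma eta k T.
Proof.
move=> k4 /GammaP[//|Ti [T1 T2 cR cG]]; apply/GammaP => //; exists Ti; split=> // U _.
  by apply: center_comm; apply/(@centralizes_center _ _ _ two_neq0 eta_neq0 1).
by apply: center_comm; apply/(@centralizes_center _ _ _ two_neq0 eta_neq0 1).
Qed.

(** For odd [n] the pseudoscalar is an odd central unit, so it can be shifted from an odd [E] into
    [W]. *)
Lemma Pgrp_Zeven_units T : odd n -> Pgrp eta T <-> Zeven_units eta T.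
Proof.
move=> on; split=> [|[W [E [cW [eE ->]]]]]; last first.
  by exists W, E; split=> //; split=> //; left.
move=> /PgrpP[W [E [[cW Wu] [eE|[oE Eu]] ->]]]; first by exists W, E.
have e0 := blade_coef_neq0 eta_neq0 [set: 'I_n] [set: 'I_n].
set ep := blade_coef _ _ _ in e0.
have oo : omega * omega = ep *: 1 by rewrite blade_sqr.
have co : center omega.
  move=> A A0 [|AT]; first by rewrite on.
  by rewrite bladeE (negPf AT).
have o1 : omega * (ep^-1 *: omega) = 1 by rewrite -scalerAr oo scalerA mulVf ?scale1r.
have o2 : (ep^-1 *: omega) * omega = 1 by rewrite -scalerAl oo scalerA mulVf ?scale1r.
exists (W * omega), (ep^-1 *: omega * E); split.
  by split; [apply: centerM|apply: cunitM => //; apply/cunitP; exists (ep^-1 *: omega)].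
split; last first.
  by rewrite -[RHS]/(W * omega * (ep^-1 *: omega * E)) mulrA -(mulrA W) o1 mulr1.
split; last by apply: cunitM => //; apply/cunitP; exists omega.
apply/(even_partP two_neq0); rewrite ginvM ginvZ ginv_blade.
have /(odd_partP two_neq0) -> := oE.
by rewrite cardsT card_ord -signr_odd on scaleN1r scalerN mulrNN.
Qed.

End Groups.

(** * Explicit units separating the groups, and the case distinction on [n] *)

Section MainTheorem.
Variables (K : numFieldType) (n : nat) (eta : 'I_n -> K).
Hypotheses (eta_neq0 : forall i, eta i != 0) (n_gt1 : (1 < n)%N).
Implicit Types (U V X T : cliff eta) (A B C : {set 'I_n}).

Let two_neq0 : (2 : K) != 0. Proof. by rewrite pnatr_eq0. Qed.

(* [(1 + c e_A) (1 - c e_A) = 1 - c^2 e_A^2], and [c = 1] or [c = 2] makes this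
   scalar nonzero. *)
Lemma exists_unit_1_plus_blade A : exists c d : K, [/\ c != 0, d != 0 &
  (1 + c *: blade eta A) * (1 - c *: blade eta A) = d *: 1 /\
  (1 - c *: blade eta A) * (1 + c *: blade eta A) = d *: 1].
Proof.
pose ep := blade_coef eta A A.
have [c c0 d0] : exists2 c : K, c != 0 & 1 - c * c * ep != 0.
  have [ep1|ep1] := eqVneq ep 1.
    exists 2; rewrite // ep1 mulr1 -natrM -[1]/(1%:R) subr_eq0 eqr_nat //.
  by exists 1; rewrite ?oner_eq0 // !mul1r subr_eq0 eq_sym.
exists c, (1 - c * c * ep); split=> //.
set x := c *: blade eta A.
have xx : x * x = (c * c * ep) *: 1 by rewrite -scalerAl -scalerAr blade_sqr !scalerA.
have -> : (1 - c * c * ep) *: 1 = 1 - x * x by rewrite scalerBl scale1r xx.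
by split; rewrite !(mulrDl, mulrDr) !(mul1r, mulr1, mulrN, mulNr) addrA ?subrK ?addrK.
Qed.

Lemma cunit_1_plus_blade (c d : K) A : d != 0 ->
  (1 + c *: blade eta A) * (1 - c *: blade eta A) = d *: 1 ->
  (1 - c *: blade eta A) * (1 + c *: blade eta A) = d *: 1 ->
  cunit eta (1 + c *: blade eta A).
Proof.
move=> d0 d1 d2; apply/cunitP; exists (d^-1 *: (1 - c *: blade eta A)).
by rewrite -scalerAl -scalerAr d1 d2 scalerA mulVf // scale1r.
Qed.

(** The witness is 1 + c e_1 with e_1 the first generator. Membership in P would give (1 - c e_1)^2
    = d S with [S] central, but the coefficient of e_1 on the left is -2c. *)
Lemma exists_unit_not_Pgrp : exists T, cunit eta T /\ ~ Pgrp eta T.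
Proof.
have A0 : [set Ordinal (ltnW n_gt1)] != set0 :> {set 'I_n}.
  by rewrite -card_gt0 cards1.
have AT : [set Ordinal (ltnW n_gt1)] != setT :> {set 'I_n}.
  by apply: contraTneq n_gt1 => /(congr1 (fun A => #|pred_of_set A|)); rewrite cards1 cardsT card_ord => <-.
set A := [set _] in A0 AT.
have oA : odd #|A| by rewrite cards1.
have [c [d [c0 d0 [d1 d2]]]] := exists_unit_1_plus_blade A.
have Tu := cunit_1_plus_blade d0 d1 d2.
exists (1 + c *: blade eta A); split=> //.
move=> /(Pgrp_ginv two_neq0 eta_neq0 n_gt1)[_ [S [cS gT]]].
have gTE : ginv (1 + c *: blade eta A) = 1 - c *: blade eta A.
  by rewrite ginvD ginv1 ginvZ ginv_blade -signr_odd oA scaleN1r scalerN.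
have := congr1 (fun X => ((1 - c *: blade eta A) * X) A) gT.
rewrite gTE mulrA d2 -scalerAl mul1r cliff_scaleE cS //; last by right.
rewrite mulrBl mul1r -scalerAl !(cliff_addE, cliff_oppE, cliff_scaleE) blade_mulE symdiffv blade_coefs0.
rewrite !(cliff_addE, cliff_oppE, cliff_scaleE) cliff_oneE bladeE (negPf A0) eqxx cliff_oneE eqxx bladeE eq_sym.
rewrite (negPf A0) !mulr0 !mulr1 subr0 add0r mulr1 -opprD => /eqP.
by rewrite oppr_eq0 -mulr2n mulrn_eq0 (negPf c0).
Qed.

(** The witness 1 + c omega is even and fixed by [reversion]. Its square lies in C^0 + C^n with top
    coefficient 2c, so it is not central, [n] being even. *)
Lemma Qgrp_neq_Q'grp : (n %% 4)%N = 0%N -> ~ seteq (Qgrp eta) (Q'grp eta).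
Proof.
move=> n4 QQ.
have en : ~~ odd n by rewrite -(odd_mod n (d := 4)) // n4.
have [c [d [c0 d0 [d1 d2]]]] := exists_unit_1_plus_blade setT.
have Tu := cunit_1_plus_blade d0 d1 d2.
set T := 1 + _ in Tu d1 d2.
have T0 := setT_neq0 n_gt1.
have T4 A : (#|A| %% 4 != 0)%N -> T A = 0.
  move=> A4; rewrite cliff_addE cliff_scaleE cliff_oneE bladeE.
  have -> : (A == set0) = false by apply: contraNF A4 => /eqP->; rewrite cards0.
  have -> : (A == setT) = false.
    by apply: contraNF A4 => /eqP->; rewrite cardsT card_ord n4.
  by rewrite mulr0 addr0.
have eT : even_part T.
  move=> A oA; apply: T4; apply: contraTneq oA => A4.
  by rewrite -(odd_mod #|A| (d := 4)) // A4.
have revT : reversion T = T.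
  by have [] := (grade_mod4P two_neq0 T (isT : (0 < 4)%N)).1 T4; rewrite scale1r.
have TT X : T * X = X + c *: (blade eta setT * X) by rewrite mulrDl mul1r -scalerAl.
have PT : Pgrp eta T.
  by apply/(Pgrp_even_n two_neq0 eta_neq0 n_gt1 _ en); left.
have Q'T : Q'grp eta T.
  split=> //; split; last exact: cunit_revM.
  have T0n : grade0n T.
    by move=> A A0 AT; rewrite cliff_addE cliff_scaleE cliff_oneE bladeE (negPf A0) (negPf AT) mulr0 addr0.
  move=> A A0 AT; rewrite -[cmul _ _ _]/(reversion T * T) revT TT cliff_addE cliff_scaleE.
  rewrite blade_mulE !T0n ?mul0r ?mulr0 ?addr0 //.
    by apply: contraNneq AT => /(congr1 (symdiff setT)); rewrite symdiffKl symdiffs0 => ->.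
  by apply: contraNneq A0 => /(congr1 (symdiff setT)); rewrite symdiffKl symdiffv => ->.
have [_ [cT _]] := (QQ T).2 Q'T.
have := cT setT T0 (or_introl en).
rewrite -[cmul _ _ _]/(reversion T * T) revT TT cliff_addE cliff_scaleE blade_mulE symdiffv.
rewrite blade_coefs0 !cliff_addE !cliff_scaleE !cliff_oneE !bladeE !eqxx [set0 == _]eq_sym (negPf T0).
rewrite mulr0 !mulr1 addr0 add0r mulr1 -mulr2n => /eqP.
by rewrite mulrn_eq0 (negPf c0).
Qed.

Lemma Theorem11_numField : Theorem11_for eta.
Proof.
have G1Q T : Gamma eta 1 T <-> Qgrp eta T.
  exact: (Gamma_odd_Qgrp two_neq0 eta_neq0 n_gt1).
have G2Q' T : Gamma eta 2 T <-> Q'grp eta T.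
  exact: (Gamma2_Q'grp two_neq0 eta_neq0 n_gt1).
have G3Q T : (4 <= n)%N -> Gamma eta 3 T <-> Qgrp eta T.
  by move=> n4; apply: (Gamma_odd_Qgrp two_neq0 eta_neq0 n_gt1).
have G0Q' T : (4 <= n)%N -> Gamma eta 0 T <-> Q'grp eta T.
  rewrite leq_eqVlt => /orP[/eqP/esym n4|n5].
    exact: (Gamma0_n4 two_neq0 eta_neq0 n_gt1).
  exact: (@Gamma_even_Q'grp _ _ _ two_neq0 eta_neq0 n_gt1 4).
have Q'Q T : (n %% 4)%N <> 0%N -> Q'grp eta T <-> Qgrp eta T.
  exact: (Q'grp_Qgrp two_neq0 eta_neq0 n_gt1).
have PQ T : (n < 4)%N -> Pgrp eta T <-> Qgrp eta T.
  by move=> n4; split=> [|[]//]; apply: (Pgrp_Qgrp two_neq0 eta_neq0 n_gt1).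
have [T0 [T0u T0P]] := exists_unit_not_Pgrp.
have c0 : (n < 4)%N -> forall U, grade_mod4 0 U -> center U.
  by move=> n4 U; apply: grade_mod4_0_center.
split.
- move=> n4 nm; split=> [T|T|T|T|].
  + exact: iff_sym (G1Q T).
  + exact: iff_sym (G3Q T n4).
  + exact: iff_sym (G0Q' T n4).
  + exact: iff_sym (G2Q' T).
  + exact: Qgrp_neq_Q'grp.
- move=> n4 nm; split=> T; apply: iff_sym.
  + exact: iff_trans (G0Q' T n4) (Q'Q T nm).
  + exact: G1Q.
  + exact: iff_trans (G2Q' T) (Q'Q T nm).
  + exact: G3Q.
- move=> n2.
  have nm : (n %% 4)%N <> 0%N by rewrite n2.
  have Peo T : Pgrp eta T <-> evenodd_units eta T.
    by apply: (Pgrp_even_n two_neq0 eta_neq0 n_gt1); rewrite n2.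
  have n4 : (n < 4)%N by rewrite n2.
  have Qeo T : Qgrp eta T <-> evenodd_units eta T.
    exact: iff_trans (iff_sym (PQ T n4)) (Peo T).
  split; first by move=> T; apply: (Gamma_trivial two_neq0 eta_neq0 n_gt1); exact: c0.
    split=> T //; first exact: iff_trans (G1Q T) (Qeo T).
    exact: iff_trans (G2Q' T) (iff_trans (Q'Q T nm) (Qeo T)).
  by move=> eo; apply/T0P/Peo/eo.
- move=> n3.
  have nm : (n %% 4)%N <> 0%N by rewrite n3.
  have Pze T : Pgrp eta T <-> Zeven_units eta T.
    by apply: (Pgrp_Zeven_units two_neq0 eta_neq0 n_gt1); rewrite n3.
  have n4 : (n < 4)%N by rewrite n3.
  have Qze T : Qgrp eta T <-> Zeven_units eta T.
    exact: iff_trans (iff_sym (PQ T n4)) (Pze T).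
  split; first by move=> T; apply: (Gamma_trivial two_neq0 eta_neq0 n_gt1); exact: c0.
  + move=> T; apply: (Gamma_trivial two_neq0 eta_neq0 n_gt1) => U U3 A A0 AT.
    apply: U3; have on : odd n by rewrite n3.
    case: AT => [|AT]; first by rewrite on.
    have A3 : (#|A| < 3)%N.
      by rewrite -n3 -[X in (_ < X)%N]card_ord -cardsT proper_card ?properT.
    by rewrite modn_small ?(ltn_trans A3) // neq_ltn A3.
  + split=> T //; first exact: iff_trans (G1Q T) (Qze T).
    exact: iff_trans (G2Q' T) (iff_trans (Q'Q T nm) (Qze T)).
  + by move=> ze; apply/T0P/Pze/ze.
- move=> _; split=> [k k4 T|T|T].
  + exact: (Gamma1_sub two_neq0 eta_neq0 n_gt1).
  + exact: G1Q.
  + split=> [/G1Q GT|[Tu pT]]; last by apply/G1Q; split=> //; apply: pT.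
    split=> [|k k4]; first by case: GT.
    by have [] := Gamma1_sub two_neq0 eta_neq0 n_gt1 k4 GT.
Qed.

End MainTheorem.

(* Real case: C = Cl_{p,q} over the reals (any realType), n = p + q >= 2.
   Complex case: C = Cl(C^n) over R[i] (the complex numbers), n >= 2. *)
Theorem mainTheorem11 :
  (forall (R : realType) (p q : nat), (2 <= p + q)%N ->
     Theorem11_for (@eta_pq R p q)) /\
  (forall (R : realType) (n : nat), (2 <= n)%N ->
     Theorem11_for (@eta_C R n)).
Proof.
split=> [R p q|R n]; apply: Theorem11_numField => i.
  by rewrite /eta_pq; case: ifP; rewrite ?oppr_eq0 oner_eq0.
exact: oner_neq0.
Qed.
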